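(* For all positive integers $n$ and $k$ and all non-negative integers $i,j,\ell$, $\mathcal{C}(n;k;i,j,\ell)=\mathcal{P}(n;k;i,j,\ell)$, where $\mathcal{C}(n;k;i,j,\ell)$ is the number of pairs $(\lambda,\mu)$ with $\lambda\in\mathcal{C}$ and $\mu$ an unrestricted ordinary partition all of whose parts are coloured $c$, of total weight $|\lambda|+|\mu|=n$, having in total (in $\lambda$ and $\mu$ together) $i$ parts coloured $a$, $j$ parts coloured $c$, $\ell$ parts coloured $d$, and all parts of value at most $k$; and $\mathcal{P}(n;k;i,j,\ell)$ is the number of $\lambda\in\mathcal{P}$ of weight $n$ having $i$ parts coloured $a$, $j$ parts coloured $b$ or $c$, $\ell$ parts coloured $d$, and all parts of value at most $k$.
   Context: A coloured integer is a positive integer $m$ with a colour, written $m_x$; its value is $m$, and the weight of a partition is the sum of the values of its parts. $\mathcal{C}$: colours $a,c,d$, total order $1_a<1_c<1_d<2_a<2_c<2_d<3_a<\cdots$. A partition in $\mathcal{C}$ is a finite sequence $\lambda_1\ge\cdots\ge\lambda_s$ (in this order, possibly empty) such that consecutive parts $\lambda_i=m_x,\lambda_{i+1}=m'_y$ satisfy $m-m'\ge C(x,y)$ with $C(a,a)=C(a,c)=C(a,d)=2$; $C(c,a)=1,C(c,c)=1,C(c,d)=2$; $C(d,a)=0,C(d,c)=1,C(d,d)=2$. $\mathcal{P}$: colours $a,b,c,d$, total order $1_a<1_b<1_c<1_d<2_a<2_b<\cdots$. A partition in $\mathcal{P}$ is a finite non-increasing (in this order) sequence with consecutive parts $m_x,m'_y$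 satisfying $m-m'\ge P(x,y)$ with $P(a,a)=2,P(a,b)=1,P(a,c)=2,P(a,d)=2$; $P(b,a)=1,P(b,b)=0,P(b,c)=1,P(b,d)=1$; $P(c,a)=0,P(c,b)=1,P(c,c)=0,P(c,d)=2$; $P(d,a)=0,P(d,b)=1,P(d,c)=0,P(d,d)=2$. *)

(* Defs.v *)
From HB Require Import structures.
From mathcomp Require Import all_boot finmap.
From mathcomp Require Import boolp classical_sets functions cardinality.

Set Implicit Arguments.
Unset Strict Implicit.
Unset Printing Implicit Defensive.

Local Open Scope classical_set_scope.
Local Open Scope fset_scope.
Local Open Scope nat_scope.

(* The functions [rankC] and [rankP] give the order of the colours:
   a < c < d and a < b < c < d. *)

Inductive colC : Type := Ca | Cc | Cd.
Inductive colP : Type := Pa | Pb | Pc | Pd.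

Definition rankC (x : colC) : nat :=
  match x with Ca => 0 | Cc => 1 | Cd => 2 end.
Definition unrankC (r : nat) : option colC :=
  match r with 0 => Some Ca | 1 => Some Cc | 2 => Some Cd | _ => None end.
Lemma rankCK : pcancel rankC unrankC. Proof. by case. Qed.
HB.instance Definition _ := Countable.copy colC (pcan_type rankCK).
Lemma colC_enumP : Finite.axiom [:: Ca; Cc; Cd]. Proof. by case. Qed.
HB.instance Definition _ := isFinite.Build colC colC_enumP.

Definition rankP (x : colP) : nat :=
  match x with Pa => 0 | Pb => 1 | Pc => 2 | Pd => 3 end.
Definition unrankP (r : nat) : option colP :=
  match r with
  | 0 => Some Pa | 1 => Some Pb | 2 => Some Pc | 3 => Some Pd | _ => None
  end.
Lemma rankPK : pcancel rankP unrankP. Proof. by case. Qed.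
HB.instance Definition _ := Countable.copy colP (pcan_type rankPK).
Lemma colP_enumP : Finite.axiom [:: Pa; Pb; Pc; Pd]. Proof. by case. Qed.
HB.instance Definition _ := isFinite.Build colP colP_enumP.

(* The part m_x is the pair (m, x); the condition 0 < m is imposed in
   [coloured_partition]. *)
Definition value (K : Type) (p : nat * K) : nat := p.1.
Definition colour (K : Type) (p : nat * K) : K := p.2.

Definition weight (K : Type) (s : seq (nat * K)) : nat :=
  sumn (map (@value K) s).

Definition count_colour (K : eqType) (x : K) (s : seq (nat * K)) : nat :=
  count (fun p => colour p == x) s.

Definition parts_le (K : Type) (k : nat) (s : seq (nat * K)) : bool :=
  all (fun p => value p <= k) s.

(* 1_a < 1_b < ... < 2_a < 2_b < ..., with colours ordered by [rank]. *)
Definition part_ge (K : Type) (rank : K -> nat) (p q : nat * K) : bool :=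
  (value q < value p) ||
  ((value q == value p) && (rank (colour q) <= rank (colour p))).

Definition coloured_partition (K : Type) (rank : K -> nat)
    (s : seq (nat * K)) : bool :=
  all (fun p => 0 < value p) s && sorted (part_ge rank) s.

(* M (colour p) (colour q) <= value p - value q, without truncation. *)
Definition gap_ok (K : Type) (M : K -> K -> nat) (p q : nat * K) : bool :=
  value q + M (colour p) (colour q) <= value p.

Definition gapC (x y : colC) : nat :=
  match x, y with
  | Ca, Ca => 2 | Ca, Cc => 2 | Ca, Cd => 2
  | Cc, Ca => 1 | Cc, Cc => 1 | Cc, Cd => 2
  | Cd, Ca => 0 | Cd, Cc => 1 | Cd, Cd => 2
  end.

Definition gapP (x y : colP) : nat :=
  match x, y with
  | Pa, Pa => 2 | Pa, Pb => 1 | Pa, Pc => 2 | Pa, Pd => 2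
  | Pb, Pa => 1 | Pb, Pb => 0 | Pb, Pc => 1 | Pb, Pd => 1
  | Pc, Pa => 0 | Pc, Pb => 1 | Pc, Pc => 0 | Pc, Pd => 2
  | Pd, Pa => 0 | Pd, Pb => 1 | Pd, Pc => 0 | Pd, Pd => 2
  end.

Definition partition_in_C (s : seq (nat * colC)) : bool :=
  coloured_partition rankC s && sorted (gap_ok gapC) s.

Definition partition_in_P (s : seq (nat * colP)) : bool :=
  coloured_partition rankP s && sorted (gap_ok gapP) s.

Definition partition_all_c (s : seq (nat * colC)) : bool :=
  coloured_partition rankC s && all (fun p => colour p == Cc) s.

Definition familyC (n k i j l : nat)
    : set (seq (nat * colC) * seq (nat * colC)) :=
  [set lm | [/\ partition_in_C lm.1, partition_all_c lm.2
              & weight lm.1 + weight lm.2 = n]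
         /\ [/\ count_colour Ca (lm.1 ++ lm.2) = i,
                count_colour Cc (lm.1 ++ lm.2) = j,
                count_colour Cd (lm.1 ++ lm.2) = l
              & parts_le k (lm.1 ++ lm.2)]].

Definition familyP (n k i j l : nat) : set (seq (nat * colP)) :=
  [set s | [/\ partition_in_P s & weight s = n]
        /\ [/\ count_colour Pa s = i,
               count_colour Pb s + count_colour Pc s = j,
               count_colour Pd s = l
             & parts_le k s]].

(* [fset_set] sends infinite sets to the empty set; [finite_familyC] and
   [finite_familyP] below show that this default is never used here. *)
Definition numC (n k i j l : nat) : nat := #|` fset_set (familyC n k i j l) |.
Definition numP (n k i j l : nat) : nat := #|` fset_set (familyP n k i j l) |.

Lemma finite_coloured_partitions (K : finType) (n : nat) :
  finite_set [set s : seq (nat * K) |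
               all (fun p => 0 < value p) s /\ weight s <= n].
Proof.
pose f (t : {bseq n of 'I_n.+1 * K}) := [seq (val p.1, p.2) | p <- t].
have fT : finite_set (f @` [set: {bseq n of 'I_n.+1 * K}]).
  exact/finite_image/finite_finset.
apply: sub_finite_set fT => s /= [s_gt0 s_le].
have size_le : size s <= n.
  apply: leq_trans s_le.
  elim: s s_gt0 => //= p s IHs /andP[p_gt0 /IHs].
  by rewrite /weight /= -add1n; apply: leq_add.
have val_le : all (fun p => value p < n.+1) s.
  elim: s s_le {s_gt0 size_le} => //= p s IHs; rewrite /weight /= => s_le.
  rewrite ltnS (leq_trans (leq_addr _ _) s_le) /=.
  exact/IHs/(leq_trans (leq_addl _ _) s_le).
have size_le' : size [seq (inord p.1 : 'I_n.+1, p.2) | p <- s] <= n.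
  by rewrite size_map.
exists (Bseq size_le') => //; rewrite /f /= -map_comp.
rewrite -[RHS]map_id; apply/eq_in_map => -[m x] /(allP val_le) /= m_lt.
by rewrite inordK.
Qed.

Lemma finite_familyC (n k i j l : nat) : finite_set (familyC n k i j l).
Proof.
have finC := @finite_coloured_partitions colC n.
apply: sub_finite_set (finite_setX finC finC) => -[s t] /=.
move=> [[/andP[/andP[sP _] _] /andP[/andP[tP _] _] <-] _].
by split; split; rewrite ?leq_addr ?leq_addl.
Qed.

Lemma finite_familyP (n k i j l : nat) : finite_set (familyP n k i j l).
Proof.
apply: sub_finite_set (@finite_coloured_partitions colP n) => s /=.
by move=> [[/andP[/andP[sP _] _] <-] _].
Qed.

(* Main.v *)
(* Cut the partitions according to their largest part: write P(al,be,ga,de)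
   for the generating function of the partitions in P whose largest part m_x has
   m at most the cap given for its colour x, and C_r(al,ga,de) likewise for the
   pairs with mu bounded by r.  Raising one cap by one adds the partitions
   starting with one given part, whose tails are again described by caps; for
   the pairs, also C_r = C_(r-1) + c q^r C_r.  These recurrences show, by
   induction on m, that P(m,m,m,m) and P(m,m,m,m-1) satisfy the same equations
   F = E + c q^m F as C_m(m,m,m) and C_m(m,m,m-1), and such an equation has only
   one solution. *)

Require Import Defs.
From mathcomp Require Import all_boot.
From mathcomp Require Import finmap boolp classical_sets cardinality zify.

Set Implicit Arguments.
Unset Strict Implicit.
Unset Printing Implicit Defensive.

Local Open Scope nat_scope.

(** * Power series as functions of the exponents *)

(* (weight, number of a's, number of b's and c's, number of d's) *)
Definition stat : Type := (nat * nat * nat * nat)%type.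

Definition add4 (u v : stat) : stat :=
  let: (n, i, j, l) := u in let: (n', i', j', l') := v in
  (n + n', i + i', j + j', l + l').

Definition sub4 (u v : stat) : stat :=
  let: (n, i, j, l) := u in let: (n', i', j', l') := v in
  (n - n', i - i', j - j', l - l').

Definition le4 (u v : stat) : bool :=
  let: (n, i, j, l) := u in let: (n', i', j', l') := v in
  [&& n <= n', i <= i', j <= j' & l <= l'].

(* A function on [stat] stands for a power series in q, a, c, d, and [shift u]
   is the multiplication by the monomial with exponents [u]. *)
Definition shift (u : stat) (F : stat -> nat) (v : stat) : nat :=
  if le4 u v then F (sub4 v u) else 0.

Lemma add4_eq (u w v : stat) : (add4 u w = v) <-> (le4 u v /\ w = sub4 v u).
Proof.
case: u w v => [[[n i] j] l] [[[n1 i1] j1] l1] [[[n2 i2] j2] l2] /=.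
split.
  by move=> -[<- <- <- <-]; rewrite !leq_addr !addKn.
by move=> [/and4P[? ? ? ?] [-> -> -> ->]]; rewrite !subnKC.
Qed.

Lemma shift_ext u F G v : F =1 G -> shift u F v = shift u G v.
Proof. by move=> FG; rewrite /shift FG. Qed.

Lemma shift_add u F G v :
  shift u (fun w => F w + G w) v = shift u F v + shift u G v.
Proof. by rewrite /shift; case: ifP. Qed.

(* Cancellation of the power series 1 - q^n a^i c^j d^l. *)
Lemma shift_fixpoint_uniq n i j l (F G E : stat -> nat) : 0 < n ->
  (forall v, F v = E v + shift (n, i, j, l) F v) ->
  (forall v, G v = E v + shift (n, i, j, l) G v) -> F =1 G.
Proof.
move=> n_gt0 F_eq G_eq [[[w i'] j'] l'].
have [m] := ubnP w; elim: m => // m IHm in w i' j' l' *; rewrite ltnS => w_le.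
rewrite F_eq G_eq /shift; case: ifP => // /and4P[n_le _ _ _] /=.
by rewrite IHm //; lia.
Qed.

(** * Counting by statistic *)

Section Count.
Variables (T : choiceType) (st : T -> stat).

Definition cnt (A : pred T) (v : stat) : nat :=
  #|` fset_set [set x | A x /\ st x = v] |.

Lemma cnt_single (x0 : T) (A : pred T) v :
  (forall x, A x <-> x = x0) -> cnt A v = (st x0 == v).
Proof.
move=> AE; rewrite /cnt; have [<-|ne] := eqVneq.
  rewrite [X in fset_set X](_ : _ = [set x0]%classic) ?fset_set1 ?cardfs1 //.
  by apply/seteqP; split => x /= => [[/AE]|->] //; split; first apply/AE.
rewrite [X in fset_set X](_ : _ = set0) ?fset_set0 ?cardfs0 //.
by apply/seteqP; split => x //= [/AE -> /eqP]; rewrite (negbTE ne).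
Qed.

(** [A'] is the disjoint union of [A] and the image of [B] under [f]. Finiteness matters because
    [fset_set] sends infinite sets to the empty set. *)
Lemma cnt_split (A A' B : pred T) (f : T -> T) u v :
  (forall w, finite_set [set x | A' x /\ st x = w]) ->
  injective f -> (forall x, st (f x) = add4 u (st x)) ->
  (forall y, A (f y) = false) -> (forall y, A' (f y) = B y) ->
  (forall x, (exists y, x = f y) \/ A' x = A x) ->
  cnt A' v = cnt A v + shift u (cnt B) v.
Proof.
move=> finA' f_inj st_f A_f A'_f A'_A.
pose X := [set x | A x /\ st x = v]%classic.
pose Y := [set f y | y in [set y | B y /\ add4 u (st y) = v]]%classic.
have XY : ([set x | A' x /\ st x = v] = X `|` Y)%classic.
  apply/seteqP; split => x /=.
    move=> [A'x stx]; have [[y xE]|xE] := A'_A x.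
      by right; exists y => //=; rewrite -A'_f -st_f -xE.
    by left; split; rewrite -?xE.
  move=> [[Ax stx]|[y [By sty] <-]]; last by rewrite A'_f st_f.
  have [[y xE]|->//] := A'_A x.
  by rewrite xE A_f in Ax.
have finXY : finite_set (X `|` Y)%classic by rewrite -XY.
have [finX finY] : finite_set X /\ finite_set Y by rewrite -finite_setU.
have disj : (X `&` Y = set0)%classic.
  by apply/seteqP; split => x //= [[Ax _] [y _ xE]]; rewrite -xE A_f in Ax.
rewrite {1}/cnt XY fset_setU // cardfsU -fset_setI // disj fset_set0 cardfs0.
rewrite subn0; congr (_ + _).
have YE : [set y | B y /\ add4 u (st y) = v]%classic =
    if le4 u v then [set y | B y /\ st y = sub4 v u]%classic else set0.
  by apply/seteqP; case: ifP => uv; split => y //=;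
    rewrite add4_eq uv // => -[_ [//]].
rewrite /shift /Y YE; case: ifP => _; last by rewrite image_set0 fset_set0.
rewrite fset_set_image; first by rewrite card_imfset.
(* The set of [y] is finite because [f] maps it injectively into the finite set [Z]. *)
pose Z := [set x | A' x /\ st x = add4 u (sub4 v u)]%classic.
apply: (@sub_finite_set _ _ (f @^-1` Z)%classic).
  by move=> y /= [By sty]; rewrite /Z /= A'_f st_f sty.
by apply: finite_preimage (finA' _) => x y _ _; apply: f_inj.
Qed.

End Count.

(** * Conditions on the first part *)

Section Heads.
Variable K : eqType.
Implicit Types (p : nat * K) (s : seq (nat * K)) (Q : pred (nat * K)).

Definition heads Q s : bool := if s is p :: _ then Q p else true.

Lemma path_heads (e : rel (nat * K)) p s :
  path e p s = heads (e p) s && sorted e s.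
Proof. by case: s. Qed.

Lemma eq_heads Q Q' s : all (fun p => 0 < value p) s ->
  (forall p, 0 < value p -> Q p = Q' p) -> heads Q s = heads Q' s.
Proof. by case: s => //= p s /andP[p_gt0 _]; apply. Qed.

Lemma part_ge_trans (rank : K -> nat) :
  transitive (part_ge rank).
Proof. by move=> q p r; rewrite /part_ge; lia. Qed.

(** The parts are non-increasing, so the first one has the largest value. *)
Lemma parts_le_heads (rank : K -> nat) k s : coloured_partition rank s ->
  parts_le k s = heads (fun p => value p <= k) s.
Proof.
case: s => // p s /andP[_ /= p_s]; apply/andb_idr => /= p_le.
have := order_path_min (@part_ge_trans rank) p_s.
apply: sub_all => q; rewrite /part_ge; lia.
Qed.

(** Since the gap condition implies the order condition, a new first part is constrained only by its
    positivity and its gap to the next part. *)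
Lemma gap_partition_cons (rank : K -> nat) (M : K -> K -> nat) p s :
  (forall p q, gap_ok M p q -> part_ge rank p q) ->
  coloured_partition rank (p :: s) && sorted (gap_ok M) (p :: s) =
  [&& 0 < value p, coloured_partition rank s && sorted (gap_ok M) s
    & heads (gap_ok M p) s].
Proof.
move=> M_rank; rewrite /coloured_partition /= !path_heads.
case: (0 < value p) => //=; case: (all _ s) => //=.
have : heads (gap_ok M p) s ==> heads (part_ge rank p) s.
  by case: s => //= q s; apply/implyP/M_rank.
lia.
Qed.

End Heads.

(** An entry 0 of [gapP] occurs only when the second colour is not above the first, so parts of
    equal value are still in order. *)
Lemma gapP_part_ge p q : gap_ok gapP p q -> part_ge rankP p q.
Proof. by case: p q => [m []] [m' []]; rewrite /gap_ok /part_ge /=; lia. Qed.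

Lemma gapC_part_ge p q : gap_ok gapC p q -> part_ge rankC p q.
Proof. by case: p q => [m []] [m' []]; rewrite /gap_ok /part_ge /=; lia. Qed.

(** * Generating functions of partitions in P *)

Definition statP (s : seq (nat * colP)) : stat :=
  (weight s, count_colour Pa s, count_colour Pb s + count_colour Pc s,
   count_colour Pd s).

Lemma statP_cons p s : statP (p :: s) = add4 (statP [:: p]) (statP s).
Proof.
rewrite /statP /add4 /count_colour /weight /=; congr (_, _, _, _); lia.
Qed.

Definition genP (Q : pred (nat * colP)) : stat -> nat :=
  cnt statP [pred s | partition_in_P s && heads Q s].

Lemma finite_statP (A : pred (seq (nat * colP))) w :
  (forall s, A s -> partition_in_P s) ->
  finite_set [set s | A s /\ statP s = w].
Proof.
case: w => [[[n i] j] l] A_P.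
apply: sub_finite_set (@finite_coloured_partitions colP n) => s /=.
by move=> [/A_P /andP[/andP[sP _] _] [<- _ _ _]].
Qed.

(** The new partitions are those starting with [p]; deleting this [p] leaves a partition whose first
    part may follow [p], which is what [B] expresses. *)
Lemma genP_step (p : nat * colP) (Q Q' B : pred (nat * colP)) v :
   0 < value p -> Q p = false -> Q' p ->
  (forall q, q != p -> Q' q = Q q) ->
  (forall q, 0 < value q -> gap_ok gapP p q = B q) ->
  genP Q' v = genP Q v + shift (statP [:: p]) (genP B) v.
Proof.
move=> p_gt0 Qp Q'p Q'Q gapB; apply: (cnt_split (f := cons p)).
- by move=> w; apply: finite_statP => s /andP[].
- by move=> s t [].
- exact: statP_cons.
- by move=> s /=; rewrite Qp andbF.
- move=> s /=; rewrite Q'p andbT /partition_in_P.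
  rewrite gap_partition_cons ?p_gt0 //=; last exact: gapP_part_ge.
  by apply: andb_id2l => /andP[/andP[s_gt0 _] _]; apply: eq_heads.
- move=> [|q s] /=; first by right.
  have [->|q_p] := eqVneq q p; first by left; exists s.
  by right; rewrite Q'Q.
Qed.

(** * Generating functions of pairs *)

Definition statC (lm : seq (nat * colC) * seq (nat * colC)) : stat :=
  (weight lm.1 + weight lm.2, count_colour Ca (lm.1 ++ lm.2),
   count_colour Cc (lm.1 ++ lm.2), count_colour Cd (lm.1 ++ lm.2)).

Lemma statC_cons1 p lm :
  statC (p :: lm.1, lm.2) = add4 (statC ([:: p], [::])) (statC lm).
Proof.
rewrite /statC /add4 /count_colour /weight /= !count_cat.
by congr (_, _, _, _); lia.
Qed.

Lemma statC_cons2 p lm :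
  statC (lm.1, p :: lm.2) = add4 (statC ([:: p], [::])) (statC lm).
Proof.
rewrite /statC /add4 /count_colour /weight /= !count_cat /=.
by congr (_, _, _, _); lia.
Qed.

Definition genC (r : nat) (Q : pred (nat * colC)) : stat -> nat :=
  cnt statC [pred lm | [&& partition_in_C lm.1, heads Q lm.1,
    partition_all_c lm.2 & heads (fun p => value p <= r) lm.2]].

Lemma finite_statC (A : pred (seq (nat * colC) * seq (nat * colC))) w :
  (forall lm, A lm -> partition_in_C lm.1 /\ partition_all_c lm.2) ->
  finite_set [set lm | A lm /\ statC lm = w].
Proof.
case: w => [[[n i] j] l] A_C.
have finC := @finite_coloured_partitions colC n.
apply: sub_finite_set (finite_setX finC finC) => -[s t] /=.
move=> [/A_C /= [/andP[/andP[sP _] _] /andP[/andP[tP _] _]] [<- _ _ _]].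
by split; split; rewrite ?leq_addr ?leq_addl.
Qed.

Lemma genC_step r (p : nat * colC) (Q Q' B : pred (nat * colC)) v :
   0 < value p -> Q p = false -> Q' p ->
  (forall q, q != p -> Q' q = Q q) ->
  (forall q, 0 < value q -> gap_ok gapC p q = B q) ->
  genC r Q' v = genC r Q v + shift (statC ([:: p], [::])) (genC r B) v.
Proof.
move=> p_gt0 Qp Q'p Q'Q gapB.
apply: (cnt_split (f := fun lm => (p :: lm.1, lm.2))).
- by move=> w; apply: finite_statC => s /and4P[].
- by move=> [s t] [s' t'] /= [-> ->].
- by move=> lm; apply: statC_cons1.
- by move=> s /=; rewrite Qp andbF.
- move=> s /=; rewrite Q'p /= /partition_in_C.
  rewrite gap_partition_cons ?p_gt0 //=; last exact: gapC_part_ge.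
  rewrite -andbA; apply: andb_id2l => /andP[/andP[s_gt0 _] _].
  by rewrite (eq_heads s_gt0 gapB).
- move=> [[|q s] t] /=; first by right.
  have [->|q_p] := eqVneq q p; first by left; exists (s, t).
  by right; rewrite Q'Q.
Qed.

Lemma all_c_cons r s :
  partition_all_c ((r.+1, Cc) :: s) =
  partition_all_c s && heads (fun p => value p <= r.+1) s.
Proof.
rewrite /partition_all_c /coloured_partition /= path_heads.
case: s => //= -[m x] s; rewrite /part_ge /value /=.
by case: x => /=; rewrite ?andbF // ?andbT; lia.
Qed.

(** The new pairs are those whose second component starts with r+1. Deleting this part keeps the
    bound r+1, as parts may repeat there. *)
Lemma genC_stepM r Q v :
  genC r.+1 Q v = genC r Q v + shift (r.+1, 0, 1, 0) (genC r.+1 Q) v.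
Proof.
apply: (cnt_split (f := fun lm => (lm.1, (r.+1, Cc) :: lm.2))).
- by move=> w; apply: finite_statC => s /and4P[].
- by move=> [s t] [s' t'] /= [-> ->].
- move=> lm; rewrite statC_cons2; congr add4.
  by rewrite /statC /weight /= !addn0.
- by move=> s /=; rewrite ltnn !andbF.
- by move=> s; rewrite [LHS]/= all_c_cons leqnn andbT.
- move=> [s [|[m x] t]]; first by right.
  have [->|mx_r] := eqVneq (m, x) (r.+1, Cc); first by left; exists (s, t).
  (* The first part has colour c, so if it is not [(r.+1, Cc)], being at most [r.+1] means being at
     most [r]. *)
  right => /=; do 2!congr (_ && _).
  apply: andb_id2l => /andP[_ /= /andP[/eqP xE _]]; move: mx_r.
  by rewrite xpair_eqE xE eqxx andbT /value /= leq_eqVlt => /negbTE->.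
Qed.

(** * Recurrences in the caps *)

Definition capP (al be ga de : nat) (p : nat * colP) : bool :=
  value p <= match colour p with Pa => al | Pb => be | Pc => ga | Pd => de end.

Definition capC (al ga de : nat) (p : nat * colC) : bool :=
  value p <= match colour p with Ca => al | Cc => ga | Cd => de end.

Local Notation P := (fun al be ga de => genP (capP al be ga de)).
Local Notation C := (fun r al ga de => genC r (capC al ga de)).

Ltac cap_step lem :=
  apply: lem => //; try (case=> [m' []]; rewrite ?xpair_eqE ?eqxx ?andbT);
  rewrite /capP /capC /gap_ok /value /=; lia.

(** The caps of the tail are [m.+1] minus the row of [Pa] in [gapP]; the other recurrences read off
    their rows likewise. Truncating a negative cap to 0 is harmless since values are positive. *)
Lemma genP_a m be ga de v : P m.+1 be ga de v =
  P m be ga de v + shift (m.+1, 1, 0, 0) (P m.-1 m m.-1 m.-1) v.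
Proof.
rewrite (_ : (m.+1, _, _, _) = statP [:: (m.+1, Pa)]); last first.
  by rewrite /statP /weight /= addn0.
cap_step (@genP_step (m.+1, Pa)).
Qed.

Lemma genP_b m al ga de v : P al m.+1 ga de v =
  P al m ga de v + shift (m.+1, 0, 1, 0) (P m m.+1 m m) v.
Proof.
rewrite (_ : (m.+1, _, _, _) = statP [:: (m.+1, Pb)]); last first.
  by rewrite /statP /weight /= addn0.
cap_step (@genP_step (m.+1, Pb)).
Qed.

Lemma genP_c m al be de v : P al be m.+1 de v =
  P al be m de v + shift (m.+1, 0, 1, 0) (P m.+1 m m.+1 m.-1) v.
Proof.
rewrite (_ : (m.+1, _, _, _) = statP [:: (m.+1, Pc)]); last first.
  by rewrite /statP /weight /= addn0.
cap_step (@genP_step (m.+1, Pc)).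
Qed.

Lemma genP_d m al be ga v : P al be ga m.+1 v =
  P al be ga m v + shift (m.+1, 0, 0, 1) (P m.+1 m m.+1 m.-1) v.
Proof.
rewrite (_ : (m.+1, _, _, _) = statP [:: (m.+1, Pd)]); last first.
  by rewrite /statP /weight /= addn0.
cap_step (@genP_step (m.+1, Pd)).
Qed.

Lemma genC_a r m ga de v : C r m.+1 ga de v =
  C r m ga de v + shift (m.+1, 1, 0, 0) (C r m.-1 m.-1 m.-1) v.
Proof.
rewrite (_ : (m.+1, _, _, _) = statC ([:: (m.+1, Ca)], [::])); last first.
  by rewrite /statC /weight /= !addn0.
cap_step (@genC_step r (m.+1, Ca)).
Qed.

Lemma genC_c r m al de v : C r al m.+1 de v =
  C r al m de v + shift (m.+1, 0, 1, 0) (C r m m m.-1) v.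
Proof.
rewrite (_ : (m.+1, _, _, _) = statC ([:: (m.+1, Cc)], [::])); last first.
  by rewrite /statC /weight /= !addn0.
cap_step (@genC_step r (m.+1, Cc)).
Qed.

Lemma genC_d r m al ga v : C r al ga m.+1 v =
  C r al ga m v + shift (m.+1, 0, 0, 1) (C r m.+1 m m.-1) v.
Proof.
rewrite (_ : (m.+1, _, _, _) = statC ([:: (m.+1, Cd)], [::])); last first.
  by rewrite /statC /weight /= !addn0.
cap_step (@genC_step r (m.+1, Cd)).
Qed.

(** * Comparison of the two families *)

Lemma genP0_genC0 v : P 0 0 0 0 v = C 0 0 0 0 v.
Proof.
rewrite /genP (cnt_single _ (x0 := [::])).
  rewrite /genC (cnt_single _ (x0 := ([::], [::]))) //.
  move=> [[|[m []] s] [|[m' x] t]] /=; split=> //;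
  rewrite /partition_in_C /partition_all_c /coloured_partition /capC /value /=;
  lia.
by move=> [|[m []] s] /=; split=> //; rewrite /partition_in_P;
  rewrite /coloured_partition /capP /value /=; lia.
Qed.

(** The second equation supports the first: a part [m.+1] coloured d leaves the cap [m.-1] for the
    next d. *)
Lemma genP_genC m :
  P m m m m =1 C m m m m /\ P m m m m.-1 =1 C m m m m.-1.
Proof.
have [j] := ubnP m; elim: j => // j IHj in m *.
case: m => [_|m]; first by split=> v; apply: genP0_genC0.
rewrite ltnS => m_lt; have [P_m N_m] := IHj m m_lt.
(* These are the tails left by a part [m.+1] coloured a. For positive [m], a part m repeats freely
   on both sides, coloured b in P and in mu for the pairs; removing it leads to the case [m.-1],
   hence the strong induction. *)
have W : P m.-1 m m.-1 m.-1 =1 C m m.-1 m.-1 m.-1.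
  case: m m_lt {P_m N_m} => [|m] m_lt v; first exact: genP0_genC0.
  have [P_m _] := IHj m (ltnW m_lt); move: v.
  apply: (@shift_fixpoint_uniq m.+1 0 1 0 _ _ (P m m m m)) => // v.
    exact: genP_b.
  by rewrite P_m; apply: genC_stepM.
(* These are the tails left by a part [m.+1] coloured d. Here the part of P coloured c repeats like
   the part m+1 of mu. *)
have R : P m.+1 m m.+1 m.-1 =1 C m.+1 m.+1 m m.-1.
  apply: (@shift_fixpoint_uniq m.+1 0 1 0 _ _ (P m.+1 m m m.-1)) => // v.
    exact: genP_c.
  by rewrite genC_stepM genC_a genP_a N_m (shift_ext _ _ W).
(* With P_m = P(m,m,m,m) and N_m = P(m,m,m,m-1), this turns the recurrences
   into N_(m+1) = P_m + a q^(m+1) W + c q^(m+1) N_m + c q^(m+1) N_(m+1). *)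
have RN v : P m.+1 m m.+1 m.-1 v + P m m.+1 m m v =
    P m.+1 m.+1 m.+1 m v + P m m m m.-1 v.
  (* The term added by raising one cap does not depend on the other caps, so it cancels between the
     two instances of each recurrence. *)
  have := (genP_c m m.+1 m m.-1 v, genP_c m m.+1 m.+1 m v).
  have := (genP_b m m.+1 m m v, genP_b m m m m v).
  have := (genP_a m m m m.-1 v, genP_a m m m m v).
  by move=> -[+ +] -[+ +] -[+ +]; lia.
have N : P m.+1 m.+1 m.+1 m =1 C m.+1 m.+1 m.+1 m.
  pose E v := P m.+1 m m m v + shift (m.+1, 0, 1, 0) (P m m m m.-1) v.
  apply: (@shift_fixpoint_uniq m.+1 0 1 0 _ _ E) => // v; rewrite /E.
    rewrite genP_c genP_b -addnA -shift_add -addnA -shift_add.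
    by congr (_ + _); apply: shift_ext => w; rewrite addnC RN addnC.
  (* For the pairs, the part m+1 coloured c gives the unknown itself when taken from mu, and N_m
     when taken from lambda. *)
  rewrite genC_stepM genC_c genC_a genP_a P_m (shift_ext _ _ W).
  by rewrite (shift_ext _ _ N_m).
split=> v //.
by rewrite genP_d genC_d N (shift_ext _ _ R).
Qed.

Theorem theorem1p10 (n k i j l : nat) (n_gt0 : 0 < n) (k_gt0 : 0 < k) :
  numC n k i j l = numP n k i j l.
Proof.
have [PC _] := genP_genC k; move: (PC (n, i, j, l)) => {}PC.
(* With all caps equal to [k], bounding the first part bounds every part. *)
have capPE s : partition_in_P s -> heads (capP k k k k) s = parts_le k s.
  by move=> /andP[/parts_le_heads -> _]; case: s => // -[m []].
have capCE s : partition_in_C s -> heads (capC k k k) s = parts_le k s.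
  by move=> /andP[/parts_le_heads -> _]; case: s => // -[m []].
transitivity (genC k (capC k k k) (n, i, j, l)); last rewrite -PC;
  rewrite /genC /genP /cnt.
- congr #|` fset_set _ |; apply/seteqP; split=> -[s t] /=.
    move=> [[sC tC stn] [si sj sl]]; rewrite /parts_le all_cat => /andP[sk tk].
    split; last by rewrite /statC /= stn si sj sl.
    apply/and4P; split=> //; first by rewrite capCE.
    by case/andP: tC => /parts_le_heads <-.
  rewrite /statC /=; move=> [/and4P[sC sk tC tk] [stn si sj sl]].
  split=> //; split=> //.
  rewrite /parts_le all_cat -/(parts_le k s) -/(parts_le k t) -capCE // sk /=.
  by case/andP: tC => /parts_le_heads ->.
- congr #|` fset_set _ |; apply/seteqP; split=> s /=.
    by move=> [/andP[sP sk] [sn si sj sl]]; do 2!split=> //; rewrite -capPE.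
  by move=> [[sP sn] [si sj sl sk]]; rewrite sP capPE // /statP sn si sj sl.
Qed.
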